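(* For all integers $n\ge0$, $b_{40}(25n+9)\equiv 0 \pmod 2$ and $b_{40}(25n+19)\equiv 0\pmod 2$.
   Context: $b_{40}(n)$ denotes the number of partitions of $n$ none of whose parts is divisible by $40$; equivalently $\sum_{n\ge0} b_{40}(n)q^n = \prod_{i\ge1}(1-q^{40i})/(1-q^i)$. *)

(* Defs.v *)
From mathcomp Require Import all_boot.

Set Implicit Arguments.
Unset Strict Implicit.
Unset Printing Implicit Defensive.

Definition is_partition (n : nat) (s : seq nat) : bool :=
  [&& sorted geq s, all (ltn 0) s & sumn s == n].

Definition is_regular_partition (l n : nat) (s : seq nat) : bool :=
  is_partition n s && all (fun i => ~~ (l %| i)) s.

(* A partition of n has at most n parts, each of size at most n, so sorting
   the partitions by their number k of parts and viewing the parts in 'I_n.+1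
   loses nothing: see regular_partitions_count. *)
Definition regular_partitions (l n : nat) : nat :=
  \sum_(k < n.+1)
    #|[set t : k.-tuple 'I_n.+1 | is_regular_partition l n (map val t)]|.

Notation b40 := (regular_partitions 40).

Lemma is_partition_bounds n s :
  is_partition n s -> size s <= n /\ all (fun i => i < n.+1) s.
Proof.
case/and3P=> _ + /eqP <-; elim: s => [|x s IH] //= /andP[x0 /IH[szs les]].
split; first by rewrite -add1n leq_add.
rewrite ltnS leq_addr /=; apply: sub_all les => i.
by rewrite !ltnS => /leq_trans; apply; rewrite leq_addl.
Qed.

Lemma regular_partitions_count l n (r : seq (seq nat)) :
  uniq r -> (forall s, (s \in r) = is_regular_partition l n s) ->
  regular_partitions l n = size r.
Proof.
move=> Ur rP.
have sz s : s \in r -> size s < n.+1.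
  by rewrite rP ltnS => /andP[/is_partition_bounds[]].
transitivity (\sum_(k < n.+1) count (fun s => size s == k) r); last first.
  transitivity (\sum_(s <- r) 1); last by rewrite sum1_size.
  transitivity (\sum_(k < n.+1) \sum_(s <- r) (size s == k)).
    by apply: eq_bigr => k _; rewrite -sum1_count big_mkcond.
  rewrite exchange_big /=; apply: eq_big_seq => s /sz szs.
  rewrite (bigD1 (Ordinal szs)) //= eqxx big1 // => k neq; case: eqP => // e.
  by case/eqP: neq; apply: val_inj.
apply: eq_bigr => k _; rewrite cardE -size_filter.
rewrite -(size_map (fun t : k.-tuple 'I_n.+1 => map val t)).
apply/perm_size/uniq_perm.
- rewrite map_inj_uniq ?enum_uniq // => t u /(inj_map val_inj).
  exact: val_inj.
- exact: filter_uniq.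
move=> s; rewrite mem_filter rP; apply/mapP/andP => [[t]|[/eqP szs Ps]].
  by rewrite mem_enum inE => Pt ->; rewrite size_map size_tuple eqxx.
have /andP[/is_partition_bounds[_ /allP les] _] := Ps.
have szt : size (map (@inord n) s) == k by rewrite size_map szs.
have es : map val (map (@inord n) s) = s.
  rewrite -map_comp -[RHS]map_id; apply/eq_in_map => i /les ilt /=.
  exact: inordK.
by exists (Tuple szt); rewrite ?mem_enum ?inE /= es.
Qed.

(* Main.v *)
Require Import Defs.
From mathcomp Require Import all_boot all_order all_algebra.
From mathcomp Require Import all_fingroup all_solvable all_field.
From mathcomp Require Import ring zify.

(** Write f_k for the product of the 1 - q^(k i), i > 0, and work modulo 2, where
    f_k^2 = f_(2k); the generating function of b40 is f_40 / f_1 = f_5^8 / f_1.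
    Let z be a fifth root of unity and C the product of the f_1(z^j q), 0 < j < 5.
    Then f_1 C f_25 = f_5^6, so f_5^8 / f_1 = C f_25 f_10.

    By Euler's identity, modulo 2 the exponents i of f_1 satisfy: 24 i + 1 is a
    square. Hence f_1 = a + b + c, with exponents in the classes 0, 1, 2 modulo 5
    respectively, and those of b are 1 modulo 25. By Gauss's identity, those of
    f_1^3 satisfy: 8 i + 1 is a square, hence they avoid the class 2 modulo 5,
    which says a c = b^2. Expanding C, its part in the class 4 modulo 5 reduces to
    b^4, whose exponents are 4 modulo 25. As f_10 has its exponents in the classes
    0, 10, 20 modulo 25, those of C f_25 f_10 avoid the classes 9 and 19. *)

Import GRing.Theory.

Set Implicit Arguments.
Unset Strict Implicit.
Unset Printing Implicit Defensive.

Local Open Scope ring_scope.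

(** * Congruence of polynomials modulo powers of X *)

Definition eqX (R : nzRingType) (L : nat) (p q : {poly R}) : Prop :=
  forall i, (i < L)%N -> p`_i = q`_i.

Lemma eqX_sym (R : nzRingType) L (p q : {poly R}) : eqX L p q -> eqX L q p.
Proof. by move=> e i iL; rewrite e. Qed.

Lemma eqX_trans (R : nzRingType) L (q p r : {poly R}) :
  eqX L p q -> eqX L q r -> eqX L p r.
Proof. by move=> e1 e2 i iL; rewrite e1 ?e2. Qed.

Lemma eqX_le (R : nzRingType) L K (p q : {poly R}) :
  (K <= L)%N -> eqX L p q -> eqX K p q.
Proof. by move=> KL e i iK; apply: e; apply: leq_trans KL. Qed.

Lemma eqXM (R : nzRingType) L (p p' q q' : {poly R}) :
  eqX L p p' -> eqX L q q' -> eqX L (p * q) (p' * q').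
Proof.
move=> e1 e2 i iL; rewrite !coefM; apply: eq_bigr => j _.
by rewrite e1 ?e2 //; apply: leq_ltn_trans iL; rewrite ?leq_subr // -ltnS.
Qed.

Lemma eqXMl (R : nzRingType) L (r p q : {poly R}) :
  eqX L p q -> eqX L (r * p) (r * q).
Proof. exact: eqXM. Qed.

Lemma eqXMr (R : nzRingType) L (r p q : {poly R}) :
  eqX L p q -> eqX L (p * r) (q * r).
Proof. by move=> e; apply: eqXM. Qed.

Lemma eqX_exp (R : nzRingType) L k (p q : {poly R}) :
  eqX L p q -> eqX L (p ^+ k) (q ^+ k).
Proof.
by move=> e; elim: k => // k IH; rewrite !exprS; apply: eqXM.
Qed.

(** A constant term 1 makes p invertible as a power series. Strong induction on the coefficient
    index avoids forming the inverse. *)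
Lemma eqX_cancel (R : nzRingType) L (p q r : {poly R}) :
  p`_0 = 1 -> eqX L (p * q) (p * r) -> eqX L q r.
Proof.
move=> p0 e i; elim/ltn_ind: i => i IH iL.
have := e i iL; rewrite !coefM !big_ord_recl /= !subn0 p0 !mul1r => H.
apply: (addIr (\sum_(j < i) p`_(bump 0 j) * q`_(i - bump 0 j))).
rewrite H; congr (_ + _); apply: eq_bigr => j _; rewrite IH //;
  have := ltn_ord j; rewrite /bump; lia.
Qed.

Lemma eqX_Xn (R : nzRingType) L k (p : {poly R}) :
  (L <= k)%N -> eqX L (p * 'X^k) 0.
Proof.
by move=> Lk i iL; rewrite coefMXn coef0 (leq_trans iL Lk).
Qed.

(** * Partial products of f_k *)

Definition qprod (R : nzRingType) (k M : nat) : {poly R} :=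
  \prod_(1 <= i < M.+1) (1 - 'X^(k * i)).
Arguments qprod {R} k M.

Lemma qprodS (R : nzRingType) k M :
  @qprod R k M.+1 = qprod k M * (1 - 'X^(k * M.+1)).
Proof. by rewrite /qprod big_nat_recr. Qed.

Lemma qprod_coef0 (R : nzRingType) k M : (0 < k)%N -> (@qprod R k M)`_0 = 1.
Proof.
move=> k0; elim: M => [|M IH]; first by rewrite /qprod big_nil coef1.
rewrite qprodS coef0M IH coefB coef1 coefXn mul1r.
suff -> : (0 == k * M.+1)%N = false by rewrite subr0.
by apply/negbTE; rewrite eq_sym -lt0n muln_gt0 k0.
Qed.

(** Each factor beyond the L-th differs from 1 only in degree at least k (L + 1) > L. *)
Lemma qprod_trunc (R : nzRingType) L k M : (0 < k)%N -> (L <= M)%N ->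
  eqX L.+1 (@qprod R k M) (qprod k L).
Proof.
move=> k0; elim: M => [|M IH]; first by rewrite leqn0 => /eqP ->.
rewrite leq_eqVlt => /predU1P[-> //|]; rewrite ltnS => LM.
rewrite qprodS mulrBr mulr1.
apply: eqX_trans (IH LM) => i iL; rewrite coefB coefMXn ifT ?subr0 //.
by nia.
Qed.

Lemma qprod_comp (R : comNzRingType) k M m : 
  @qprod R k M \Po 'X^m = qprod (m * k) M.
Proof.
rewrite /qprod rmorph_prod; apply: eq_bigr => i _.
by rewrite rmorphB rmorphXn /= comp_polyX rmorph1 -exprM mulnA.
Qed.

Lemma qprod_sqr (R : comNzRingType) k M : 2 \in [pchar R] ->
  qprod k M ^+ 2 = @qprod R (2 * k) M.
Proof.
move=> c2; rewrite /qprod -prodrXl; apply: eq_bigr => i _.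
have c2' : 2 \in [pchar {poly R}] by rewrite (pchar_poly R).
rewrite sqrrB expr1n -exprM mul1r -mulr_natr (pcharf0 c2') mulr0 subr0.
by rewrite (oppr_pchar2 c2'); congr (_ + 'X^_); lia.
Qed.

(** * Finite forms of Euler's and Gauss's identities (Shanks) *)

(* The summand for n.+1 is the one for n up to a telescoping difference; only
   the term s = 0 of the left-hand side survives modulo X^(n+1). *)
Lemma shanks_euler (R : comNzRingType) n :
  \sum_(s < n.+1) (-1) ^+ s * (\prod_(s.+1 <= i < n.+1) (1 - 'X^i))
                  * 'X^(s * n + 'C(s.+1, 2))
  = 1 + \sum_(s < n) (-1) ^+ s.+1
      * ('X^(s.+1 * s.+1 + 'C(s.+1, 2)) + 'X^(s.+1 * s.+1 + 'C(s.+2, 2)))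
  :> {poly R}.
Proof.
pose A n s : {poly R} := (-1) ^+ s * (\prod_(s.+1 <= i < n.+1) (1 - 'X^i))
  * 'X^(s * n + 'C(s.+1, 2)).
elim: n => [|n IH].
  by rewrite big_ord1 big_ord0 big_nil !mulr1 addr0.
have diag m : A m m = (-1) ^+ m * 'X^(m * m + 'C(m.+1, 2)).
  by rewrite /A big_geq // mulr1.
rewrite [X in _ = _ + X]big_ord_recr /= addrA -IH big_ord_recr /= -/(A n.+1 n.+1).
(* The new factor 1 - X^(n+1) produces the correction [V s], which cancels against the difference of
   the next summand, s.+1. Only - [V n] is left. *)
pose V s := A n s * 'X^(n.+1 + s).
have step (s : 'I_n.+1) : true -> A n.+1 s = A n s + (A n s * ('X^s - 1) - V s).
  move=> _; rewrite /V /A big_nat_recr ?ltnS ?leq_ord //=.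
  rewrite [in LHS]mulnS addnAC addnC !exprD [_ ^+ n.+1]exprS; ring.
rewrite (eq_bigr _ step) big_split /= -addrA; congr (_ + _).
rewrite sumrB big_ord_recl /= expr0 subrr mulr0 add0r big_ord_recr /=.
have tele (s : 'I_n) : true ->
    A n (bump 0 s) * ('X^(bump 0 s) - 1) = V s.
  move=> _; rewrite /V /A /bump /= add1n (@big_ltn _ _ _ s.+1) ?ltnS //.
  rewrite [in X in _ = X]exprD (binS s.+1) bin1.
  have -> : (s.+1 * n + ('C(s.+1, 2) + s.+1) = s * n + 'C(s.+1, 2) + (n.+1 + s))%N by lia.
  rewrite !exprD exprS; ring.
rewrite (eq_bigr _ tele) opprD addNKr /V !diag.
(* The leftover - [V n] and the new summand s = n.+1 are the two pentagonal powers added on the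
   right. *)
rewrite [in RHS]mulrDr -mulrA -exprD. congr (_ + _).
rewrite exprS mulN1r mulNr; congr (- (_ * 'X^_)).
by lia.
Qed.

(* Gauss's identity f_2^2 / f_1 = sum of the q^(s(s+1)/2), multiplied by the
   finite product of the odd factors to avoid denominators. *)
Lemma shanks_gauss (R : comNzRingType) n :
  \sum_(s < n) (\prod_(j < s) (1 - 'X^((2 * j).+1)))
     * (\prod_(s.+1 <= j < n.+1) (1 - 'X^(2 * j))) * 'X^(s * (2 * n).+1)
  = (\prod_(j < n) (1 - 'X^((2 * j).+1))) * \sum_(s < 2 * n) 'X^('C(s.+1, 2))
  :> {poly R}.
Proof.
pose D n : {poly R} := \prod_(j < n) (1 - 'X^((2 * j).+1)).
pose E s n : {poly R} := \prod_(s.+1 <= j < n.+1) (1 - 'X^(2 * j)).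
pose B n s := D s * E s n * 'X^(s * (2 * n).+1).
have DS m : D m.+1 = D m * (1 - 'X^((2 * m).+1)) by rewrite /D big_ord_recr.
elim: n => [|n IH]; first by rewrite !big_ord0 mulr0.
have -> : (2 * n.+1 = (2 * n).+2)%N by lia.
rewrite [X in _ = _ * X]big_ord_recr [X in _ = _ * (X + _)]big_ord_recr /=.
rewrite -/(D n.+1).
pose c : {poly R} := 'X^((2 * n).+1).
(* [C] is the telescoping part: [C 0] = 0, so its differences sum to [C n], and the factor 1 - c
   multiplies the sum known by induction. *)
pose C s := (1 - 'X^(2 * s)) * B n s.
have step (s : 'I_n) : true -> D s * E s n.+1 * 'X^(s * (2 * n).+3)
    = (1 - c) * B n s + (C s.+1 - C s).
  move=> _; have sn := ltn_ord s.
  have -> : C s.+1 = (1 - 'X^((2 * s).+1)) * c * B n s.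
    rewrite /C /B DS {2}/E big_ltn //= -/(E s.+1 n) (mulSn s) exprD.
    by rewrite -/c; ring.
  rewrite /C /B {1}/E big_nat_recr ?(leqW sn) //= -/(E s n).
  have -> : (s * (2 * n).+3 = s * (2 * n).+1 + 2 * s)%N by lia.
  have -> : (2 * n.+1 = (2 * n).+1 + 1)%N by lia.
  by move: (2 * s)%N => e; rewrite /c !exprD expr1 (exprS _ e); ring.
rewrite big_ord_recr /= (eq_bigr _ step) big_split /= -mulr_sumr IH.
rewrite -(big_mkord predT (fun s => C s.+1 - C s)) telescope_sumr //.
have -> : C 0 = 0 by rewrite /C muln0 subrr mul0r.
rewrite DS subr0 /C /B /E big_geq // big_ltn // big_geq // -/c.
have -> : 'C((2 * n).+1, 2) = (n * (2 * n).+1)%N.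
  by rewrite bin2 /=; lia.
have -> : 'C((2 * n).+2, 2) = (n * (2 * n).+1 + (2 * n).+1)%N.
  by rewrite bin2 /=; lia.
have -> : (n * (2 * n).+3 = n * (2 * n).+1 + 2 * n)%N by lia.
have -> : (2 * n.+1 = (2 * n).+1 + 1)%N by lia.
rewrite /c -/(D n); move: (2 * n)%N => e.
rewrite !exprD !exprS expr0. ring.
Qed.

(** The exponents in Euler's identity are the pentagonal numbers t(3t - 1)/2 and t(3t + 1)/2, for
    which 24 i + 1 is (6t - 1)^2 or (6t + 1)^2. *)
Lemma qprod1_coef (R : comNzRingType) n i : (i <= n)%N ->
  (@qprod R 1 n)`_i != 0 -> exists m, (24 * i + 1 = m * m)%N.
Proof.
move=> le_in; have : _`_i = _`_i := congr1 (fun p : {poly R} => p`_i) (shanks_euler R n).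
rewrite big_ord_recl coefD coef_sum [X in _ + X = _]big1 => [|s _]; last first.
  (* The summands with s > 0 are multiples of X^(n+1), and i is at most n. *)
  rewrite (@eqX_Xn _ i.+1) ?coef0 // lift0 (leq_trans (n := (n + 1)%N)) //; first by lia.
  by rewrite binS bin1; nia.
rewrite mul0n !mulr1 addr0 mul1r coefD coef1 coef_sum => eq_i.
have -> : @qprod R 1 n = \prod_(1 <= j < n.+1) (1 - 'X^j).
  by apply: eq_bigr => j _; rewrite mul1n.
rewrite {}eq_i; case: i le_in => [|i] le_in; first by exists 1%N.
rewrite add0r; have [s e _ | none] := pickP (fun s : 'I_n =>
  (i.+1 == s.+1 * s.+1 + 'C(s.+1, 2))%N || (i.+1 == s.+1 * s.+1 + 'C(s.+2, 2))%N).
  have [b1 b2] : ('C(s.+1, 2) * 2 = s.+1 * s)%N /\ ('C(s.+2, 2) * 2 = s.+2 * s.+1)%N.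
    by rewrite !bin2 !muln2 !halfK !oddM /= negbK andbN ?andNb !subn0.
  (* With t = s + 1, these are 6t - 1 and 6t + 1. *)
  by case/orP: e => /eqP ->; [exists (6 * s + 5)%N|exists (6 * s + 7)%N]; nia.
rewrite big1 ?eqxx // => s _; have /norP[/negPf h1 /negPf h2] := negbT (none s).
have -> : (-1) ^+ s.+1 = ((-1) ^+ s.+1)%:P :> {poly R} by rewrite rmorphXn rmorphN1.
by rewrite coefCM coefD !coefXn h1 h2 addr0 mulr0.
Qed.

Lemma qprod_odd_even (R : comNzRingType) n :
  (\prod_(j < n) (1 - 'X^((2 * j).+1))) * qprod 2 n = @qprod R 1 (2 * n).
Proof.
elim: n => [|n IH]; first by rewrite big_ord0 /qprod !big_nil mulr1.
rewrite big_ord_recr [X in _ * X]qprodS /=.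
have -> : (2 * n.+1 = (2 * n).+2)%N by lia.
rewrite !qprodS -IH !mul1n.
by ring.
Qed.

(** Modulo 2, f_1^4 = f_2^2. Gauss's identity turns one factor f_2 into G times the odd factors, and
    these with the other f_2 restore f_1. So f_1^4 = f_1 G, and f_1 cancels. The index n.+1 keeps
    the sum nonempty. *)
Lemma qprod1_cube (R : comNzRingType) n : 2 \in [pchar R] ->
  eqX n.+2 (@qprod R 1 n.+1 ^+ 3) (\sum_(s < 2 * n.+1) 'X^('C(s.+1, 2))).
Proof.
move=> c2; set G := \sum_(s < _) _; set f := qprod 1 n.+1.
have gauss : eqX n.+2 (qprod 2 n.+1)
    ((\prod_(j < n.+1) (1 - 'X^((2 * j).+1))) * G).
  rewrite -shanks_gauss big_ord_recl big_ord0 mul1r mul0n mulr1 => i iL.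
  rewrite coefD coef_sum [X in _ + X]big1 ?addr0 // => s _.
  by rewrite (@eqX_Xn _ n.+2) ?coef0 // lift0; lia.
apply: (@eqX_cancel _ _ f); first exact: qprod_coef0.
rewrite -exprS (exprM f 2 2) qprod_sqr // muln1 expr2.
apply: eqX_trans (eqXMl _ gauss) _.
rewrite mulrA [X in X * G]mulrC qprod_odd_even; apply: eqXMr.
by apply: qprod_trunc => //; lia.
Qed.

Lemma qprod1_cube_coef (R : comNzRingType) n i : 2 \in [pchar R] ->
  (i <= n.+1)%N -> (@qprod R 1 n.+1 ^+ 3)`_i != 0 ->
  exists m, (8 * i + 1 = m * m)%N.
Proof.
move=> c2 le_in; rewrite qprod1_cube // coef_sum.
have [s /eqP -> _ | none] := pickP (fun s : 'I_(2 * n.+1) => i == 'C(s.+1, 2)).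
  have b : ('C(s.+1, 2) * 2 = s.+1 * s)%N.
    by rewrite bin2 muln2 halfK oddM /= andNb subn0.
  (* Eight times the triangular number s(s+1)/2, plus 1, is (2s + 1)^2. *)
  by exists (2 * s + 1)%N; nia.
by rewrite big1 ?eqxx // => s _; rewrite coefXn none.
Qed.

(** * The generating function of regular partitions *)

(* Meaningful when the fuel d exceeds m + n; m bounds the parts. *)
Fixpoint rparts (l d m n : nat) : seq (seq nat) :=
  if d is d'.+1 then
    if m is m'.+1 then
      rparts l d' m' n ++
      (if (l %| m)%N || (n < m)%N then [::]
       else map (cons m) (rparts l d' m (n - m)))
    else if n is 0 then [:: [::]] else [::]
  else [::].

Lemma rparts_mem l d m n s : (m + n < d)%N ->
  (s \in rparts l d m n) =
  is_regular_partition l n s && all (fun i => i <= m)%N s.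
Proof.
elim: d m n s => // d IH [|m] n s lt_d /=.
  case: s => [|x s]; first by case: n {lt_d}.
  have -> : (x :: s \in (if n is 0 then [:: [::]] else [::])) = false by case: n {lt_d}.
  rewrite /is_regular_partition /is_partition /= leqn0.
  by case: x => [|x] /=; rewrite ?andbF.
rewrite mem_cat IH; last by lia.
have -> : (s \in (if (l %| m.+1)%N || (n < m.+1)%N then [::]
                  else [seq m.+1 :: i | i <- rparts l d m.+1 (n - m.+1)])) =
   (if s is x :: s' then [&& x == m.+1, ~~ (l %| m.+1), m.+1 <= n &
     is_regular_partition l (n - m.+1) s' && all (fun i => i <= m.+1)%N s']%N else false).
  case: ifP => [|/norP[nl nm]].
    case: s => // x s /orP[-> | ]; first by rewrite andbF.
    by rewrite ltnNge => /negPf->; rewrite !andbF.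
  case: s => [|x s]; first by apply/negP => /mapP[].
  rewrite nl leqNgt nm /= -IH; last by lia.
  apply/mapP/andP => [[s' s'P [-> ->]]|[/eqP -> sP]]; first by rewrite eqxx.
  by exists s.
case: s => [|x s]; first by rewrite orbF.
have geq_tr : transitive geq by move=> a b c h1 h2; apply: leq_trans h2 h1.
rewrite /is_regular_partition /is_partition /= (path_sortedE geq_tr).
(* A list whose head is not m.+1 can only come from the first half. There the head bounds all parts,
   since the list is sorted. *)
have [->|neq] := eqVneq x m.+1; last first.
  rewrite orbF (leq_eqVlt x m.+1) (negPf neq) ltnS /=.
  case: (leqP x m) => [le_xm|_]; rewrite ?andbF //=.
  case le_s: (all (geq x) s) => //=.
  have le_sk k : (x <= k)%N -> all (fun i => i <= k)%N s.
    by move=> xk; apply: sub_all le_s => i /leq_trans; apply.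
  by rewrite !le_sk // leqW.
rewrite ltnn ltnSn !andbF /=.
have -> : all (geq m.+1) s = all (fun i => i <= m.+1)%N s by [].
case: (all (fun i => i <= m.+1)%N s); rewrite ?andbF //= !andbT.
have -> : (m.+1 + sumn s == n)%N = (m < n)%N && (sumn s == n - m.+1)%N.
  by apply/eqP/andP => [|[? /eqP]]; [split; [|apply/eqP]|]; lia.
by case: (~~ (l %| _)%N); case: (m < n)%N; rewrite ?andbF ?andbT.
Qed.

Lemma rparts_fuel l d d' m n : (m + n < d)%N -> (m + n < d')%N ->
  rparts l d m n = rparts l d' m n.
Proof.
elim: d d' m n => // d IH [|d'] [|m] n //= h h'.
rewrite (IH d' m n); [|lia|lia]; congr (_ ++ _).
case: ifP => // /norP[_]; rewrite -leqNgt => le_mn.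
by rewrite (IH d' m.+1) //; lia.
Qed.

Lemma rparts_uniq l d m n : (m + n < d)%N -> uniq (rparts l d m n).
Proof.
elim: d m n => // d IH [|m] n lt_d /=; first by case: n {lt_d}.
rewrite cat_uniq IH; last by lia.
case: ifP => // /norP[_]; rewrite -leqNgt => le_mn.
rewrite map_inj_uniq ?IH ?andbT; [|by lia|by move=> s t []].
apply/hasPn => s /mapP[t _ ->].
by rewrite rparts_mem /= ?ltnn ?andbF //; lia.
Qed.

Definition nparts l m n := size (rparts l (m + n).+1 m n).

Lemma npartsE l m n : (n <= m)%N -> nparts l m n = regular_partitions l n.
Proof.
move=> le_nm; apply/esym/regular_partitions_count; first exact: rparts_uniq.
move=> s; rewrite rparts_mem //; apply: andb_idr.
case/andP=> /is_partition_bounds[_ /allP le_s] _.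
by apply/allP => i /le_s; rewrite ltnS => /leq_trans; apply.
Qed.

(** Either m.+1 does not occur as a part, or one copy of it can be removed. *)
Lemma npartsS l m n : nparts l m.+1 n =
  (nparts l m n + (if (l %| m.+1) || (n < m.+1) then 0
                   else nparts l m.+1 (n - m.+1)))%N.
Proof.
have unfold d : rparts l d.+1 m.+1 n = rparts l d m n ++
   (if (l %| m.+1)%N || (n < m.+1)%N then [::]
    else map (cons m.+1) (rparts l d m.+1 (n - m.+1))) by [].
rewrite {1}/nparts unfold size_cat; congr (_ + _)%N.
case: ifP => // /norP[_]; rewrite -leqNgt => le_mn.
by rewrite size_map /nparts; congr size; apply: rparts_fuel; lia.
Qed.

Lemma prod_multiples (R : comNzRingType) (F : nat -> R) l L : (0 < l)%N ->
  \prod_(1 <= i < (l * L).+1 | (l %| i)%N) F i = \prod_(1 <= j < L.+1) F (l * j)%N.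
Proof.
case: l => // l _; elim: L => [|L IH]; first by rewrite muln0 !big_nil.
rewrite [RHS]big_nat_recr //= -IH (@big_cat_nat _ _ _ (l.+1 * L).+1) //=; last by lia.
congr (_ * _).
have -> : (l.+1 * L.+1 = (l.+1 * L + l).+1)%N by lia.
rewrite big_mkcond big_nat_recr /=; last by lia.
rewrite ifT; last by apply/dvdnP; exists L.+1; lia.
(* Among the l.+1 indices of the last block, only the final one is a multiple of l.+1. *)
rewrite big_nat big1 ?mul1r => [|i /andP[lt_i gt_i]]; first by congr F; lia.
case: ifP => // /dvdnP[k Ek]; exfalso; case: (leqP k L) => h; subst i.
  have := leq_mul h (leqnn l.+1); lia.
have := leq_mul h (leqnn l.+1); lia.
Qed.

(** By [npartsS], multiplying the polynomial for m.+1 by 1 - X^(m+1) gives the one for m, unless l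
    divides m.+1, when the two polynomials are equal and the factor stays on the right. *)
Lemma nparts_gen (R : comNzRingType) l L m :
  eqX L (qprod 1 m * \poly_(n < L) (nparts l m n)%:R)
    (\prod_(1 <= i < m.+1 | (l %| i)%N) (1 - 'X^i) : {poly R}).
Proof.
elim: m => [|m IH].
  rewrite /qprod !big_nil mul1r => i iL; rewrite coef_poly iL coef1.
  by case: i iL.
have -> : \prod_(1 <= i < m.+2 | (l %| i)%N) (1 - 'X^i) =
   (\prod_(1 <= i < m.+1 | (l %| i)%N) (1 - 'X^i)) *
   (if (l %| m.+1)%N then 1 - 'X^(m.+1) else 1) :> {poly R}.
  by rewrite big_mkcond big_nat_recr //= -big_mkcond.
have {IH} := eqXMr (if (l %| m.+1)%N then 1 - 'X^(m.+1) else 1) IH.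
move/(eqX_trans _); apply; rewrite qprodS mul1n -!mulrA; apply: eqXMl.
case: ifP => [dv|ndv].
  rewrite mulrC; apply: eqXMr => i iL.
  by rewrite !coef_poly iL npartsS dv addn0.
move=> i iL; rewrite mulr1 mulrBl mul1r coefB coefXnM !coef_poly iL npartsS ndv /=.
case: ltnP => mi; first by rewrite addn0 subr0.
by rewrite (leq_ltn_trans (leq_subr _ _) iL) natrD addrK.
Qed.

Lemma regular_gen (R : comNzRingType) l L : (0 < l)%N ->
  eqX L (qprod 1 L * \poly_(n < L) (regular_partitions l n)%:R) (@qprod R l L).
Proof.
move=> l0; rewrite /(qprod l L) -(prod_multiples (fun i => 1 - 'X^i)) //.
(* Bounding the parts by l L leaves exactly L multiples of l, and loses no partition of any n <
   L. *)
apply: (eqX_trans _ (@nparts_gen R l L (l * L))); apply: eqXM.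
  apply/eqX_sym/(eqX_le (leqnSn L))/qprod_trunc => //; nia.
by move=> i iL; rewrite !coef_poly iL npartsE //; nia.
Qed.

(** * The norm for the substitutions X -> z X, z^5 = 1 *)

(** The field with 16 elements has 15 units, so Cauchy's theorem gives a unit u of order 5. Then u -
    1 is nonzero and cancels from u^5 - 1 = 0. *)
Lemma field_char2_root5 : exists (F : fieldType) (z : F),
  2 \in [pchar F] /\ 1 + z + z ^+ 2 + z ^+ 3 + z ^+ 4 = 0.
Proof.
have [F c2 cardF] := @PrimePowerField 2 4 isT isT.
have card_units : #|[set: {unit F}]| = 15%N by rewrite card_finField_unit cardF.
have dvd5 : (5 %| #|[set: {unit F}]|)%N by rewrite card_units.
have [u _ ord_u] := @Cauchy _ 5 [set: {unit F}]%G isT dvd5.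
exists F, (val u); split=> //.
have u5 : val u ^+ 5 = 1 by rewrite -FinRing.val_unitX -ord_u expg_order.
have u1 : val u - 1 != 0.
  rewrite subr_eq0; apply/eqP => e.
  have eu : u = 1%g by apply: val_inj.
  by rewrite eu order1 in ord_u.
apply: (mulfI u1); rewrite mulr0.
by transitivity (val u ^+ 5 - 1); [ring | rewrite u5 subrr].
Qed.

Lemma pow5_root5 (R : comNzRingType) (z : R) :
  1 + z + z ^+ 2 + z ^+ 3 + z ^+ 4 = 0 -> z ^+ 5 = 1.
Proof.
move=> rz; apply: subr0_eq; rewrite -[RHS](mulr0 (z - 1)) -[in RHS]rz; ring.
Qed.

(** Only i modulo 5 matters, and a nonzero class just permutes the powers of z. *)
Lemma root5X (R : comNzRingType) (z : R) i :
  1 + z + z ^+ 2 + z ^+ 3 + z ^+ 4 = 0 -> ~~ (5 %| i)%N ->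
  1 + z ^+ i + (z ^+ i) ^+ 2 + (z ^+ i) ^+ 3 + (z ^+ i) ^+ 4 = 0.
Proof.
move=> rz; have z5 := pow5_root5 rz.
rewrite -(expr_mod i z5) /dvdn; have := ltn_pmod i (isT : 0 < 5)%N.
move: (i %% 5)%N => [|[|[|[|[|r]]]]] // _ _; rewrite -rz -?exprM ?expr1 //.
- rewrite (exprD z 5 1) (exprD z 5 3) z5; ring.
- rewrite (exprD z 5 1) (exprD z 5 4) (exprM z 3 4) -exprM (exprD z 10 2) (exprM z 5 2) z5; ring.
- rewrite (exprD z 5 3) (exprD z 10 2) (exprD z 15 1) (exprM z 5 2) (exprM z 5 3) z5; ring.
Qed.

(** The right-hand side is sorted by weight modulo 5, where a, b, c have weights 0, 1, 2: the terms
    before the last bracket have weight 4, those inside it have other weights. *)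
Lemma conj_prod_expand (R : comNzRingType) (z a b c : R) :
  1 + z + z ^+ 2 + z ^+ 3 + z ^+ 4 = 0 ->
  (a + z * b + z ^+ 2 * c) * (a + z ^+ 2 * b + z ^+ 4 * c)
    * (a + z ^+ 3 * b + z ^+ 6 * c) * (a + z ^+ 4 * b + z ^+ 8 * c) =
  b ^+ 4 + a * c * (a * c + b ^+ 2) - 4 * (a * b ^+ 2 * c)
  + (a ^+ 4 + c ^+ 4 + a ^+ 2 * b ^+ 2 + b ^+ 2 * c ^+ 2 - a ^+ 3 * b
     + 2 * (a ^+ 2 * b * c) - a * b ^+ 3 - b ^+ 3 * c + 2 * (a * b * c ^+ 2)
     - b * c ^+ 3 - a ^+ 3 * c - a * c ^+ 3).
Proof.
move=> rz; have z5 := pow5_root5 rz.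
(* These are the Gaussian periods, with sum and product -1. Pairing each conjugate with its inverse
   gives two factors that differ by swapping [al] and [be]. *)
pose al := z + z ^+ 4; pose be := z ^+ 2 + z ^+ 3.
pose S := a ^+ 2 + b ^+ 2 + c ^+ 2; pose T := a * b + b * c; pose U := a * c.
have sum : al + be = -1.
  by apply: subr0_eq; rewrite -[RHS]rz /al /be; ring.
have prod : al * be = -1.
  rewrite -sum /al /be.
  have -> : (z + z ^+ 4) * (z ^+ 2 + z ^+ 3)
    = z ^+ 3 + z ^+ 4 + z ^+ 5 * (z + z ^+ 2) by ring.
  by rewrite z5; ring.
have z6 : z ^+ 6 = z by rewrite exprS z5 mulr1.
have z8 : z ^+ 8 = z ^+ 3 by rewrite (exprD z 5 3) z5 mul1r.
have e1 : (a + z * b + z ^+ 2 * c) * (a + z ^+ 4 * b + z ^+ 8 * c)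
          = S + al * T + be * U.
  rewrite z8; apply: subr0_eq.
  transitivity ((z ^+ 5 - 1) * (b ^+ 2 + c ^+ 2 + z * b * c)).
    by rewrite /S /al /be /T /U; ring.
  by rewrite z5 subrr mul0r.
have e2 : (a + z ^+ 2 * b + z ^+ 4 * c) * (a + z ^+ 3 * b + z ^+ 6 * c)
          = S + be * T + al * U.
  rewrite z6; apply: subr0_eq.
  transitivity ((z ^+ 5 - 1) * (b ^+ 2 + c ^+ 2 + z ^+ 2 * b * c)).
    by rewrite /S /al /be /T /U; ring.
  by rewrite z5 subrr mul0r.
transitivity ((S + al * T + be * U) * (S + be * T + al * U)).
  by rewrite -e1 -e2; ring.
have -> : (S + al * T + be * U) * (S + be * T + al * U) =
  S ^+ 2 + (al + be) * S * (T + U) + al * be * (T ^+ 2 + U ^+ 2)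
  + ((al + be) ^+ 2 - 2 * (al * be)) * T * U by ring.
by rewrite sum prod /S /T /U; ring.
Qed.

Definition dilate (R : comNzRingType) (z : R) (p : {poly R}) : {poly R} :=
  p \Po (z *: 'X).

Lemma coef_dilate (R : comNzRingType) (z : R) p i : (dilate z p)`_i = z ^+ i * p`_i.
Proof.
rewrite /dilate comp_polyE coef_sum.
have [lt_i|le_i] := ltnP i (size p); last first.
  rewrite [p`_i]nth_default // mulr0 big1 // => j _.
  rewrite exprZn !coefZ coefXn gtn_eqF ?mulr0 //.
  exact: leq_trans (ltn_ord j) le_i.
rewrite (bigD1 (Ordinal lt_i)) //= big1 => [|j ne]; rewrite exprZn !coefZ coefXn.
  by rewrite eqxx addr0 mulr1 mulrC.
by rewrite (_ : (i == j) = false) ?mulr0 //; apply: contraNF ne => /eqP e; apply/eqP/val_inj.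
Qed.

Definition conj_prod (R : comNzRingType) (z : R) (p : {poly R}) : {poly R} :=
  dilate z p * dilate (z ^+ 2) p * dilate (z ^+ 3) p * dilate (z ^+ 4) p.

Lemma conj_prodM (R : comNzRingType) (z : R) p q :
  conj_prod z (p * q) = conj_prod z p * conj_prod z q.
Proof. by rewrite /conj_prod /dilate !rmorphM /=; ring. Qed.

Lemma dilateXn (R : comNzRingType) (z : R) i :
  dilate z (1 - 'X^i) = 1 - z%:P ^+ i * 'X^i.
Proof.
by rewrite /dilate rmorphB rmorph1 rmorphXn /= comp_polyX -mul_polyC exprMn.
Qed.

Lemma norm_Xn (R : comNzRingType) (z : R) i :
  1 + z + z ^+ 2 + z ^+ 3 + z ^+ 4 = 0 ->
  (1 - 'X^i) * conj_prod z (1 - 'X^i) =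
    if (5 %| i)%N then (1 - 'X^i) ^+ 5 else 1 - 'X^(5 * i).
Proof.
move=> rz; have z5 := pow5_root5 rz.
rewrite /conj_prod !dilateXn !rmorphXn /= !(exprAC _ _ i).
set w := z%:P ^+ i.
case: ifPn => [/dvdnP[k ek]|nd].
  have -> : w = 1 by rewrite /w ek mulnC exprM -rmorphXn z5 rmorph1 expr1n.
  by rewrite !expr1n; ring.
have rw : 1 + w + w ^+ 2 + w ^+ 3 + w ^+ 4 = 0.
  have := congr1 polyC (root5X rz nd).
  by rewrite !rmorphD !rmorphXn rmorph1 rmorph0.
(* For c = 0 and Y = X^i the expansion is 1 + Y + Y^2 + Y^3 + Y^4, the cofactor of 1 - Y in 1 -
   Y^5. *)
have := @conj_prod_expand _ w 1 (- 'X^i) 0 rw.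
rewrite !mulr0 !addr0 !mulrN => ->.
by rewrite mulnC exprM; ring.
Qed.

(** The indices divisible by 5 contribute f_5^5. The others contribute the factors of f_5 except
    those 1 - X^(5i) with 5 dividing i, which f_25 supplies. *)
Lemma norm_qprod (R : comNzRingType) (z : R) L :
  1 + z + z ^+ 2 + z ^+ 3 + z ^+ 4 = 0 ->
  qprod 1 (5 * L) * conj_prod z (qprod 1 (5 * L)) * qprod 25 L
  = qprod 5 (5 * L) * qprod 5 L ^+ 5.
Proof.
move=> rz; pose N i : {poly R} := if (5 %| i)%N then (1 - 'X^i) ^+ 5 else 1 - 'X^(5 * i).
have norm M : qprod 1 M * conj_prod z (qprod 1 M) = \prod_(1 <= i < M.+1) N i.
  elim: M => [|M IH].
    by rewrite /qprod !big_nil /conj_prod /dilate !rmorph1 !mulr1.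
  by rewrite big_nat_recr //= -IH /N -(norm_Xn _ rz) qprodS mul1n conj_prodM; ring.
have -> : qprod 25 L = \prod_(1 <= i < (5 * L).+1 | (5 %| i)%N) (1 - 'X^(5 * i)) :> {poly R}.
  rewrite (prod_multiples (fun i => 1 - 'X^(5 * i))) //.
  by apply: eq_bigr => i _; rewrite mulnA.
have -> : qprod 5 L ^+ 5 = \prod_(1 <= i < (5 * L).+1 | (5 %| i)%N) (1 - 'X^i) ^+ 5 :> {poly R}.
  by rewrite (prod_multiples (fun i => (1 - 'X^i) ^+ 5)) // -prodrXl.
rewrite norm /qprod ![\prod_(_ <= _ < _ | _) _]big_mkcond -!big_split /=.
by apply: eq_bigr => i _; rewrite /N; case: ifP => _; rewrite ?mulr1 // mulrC.
Qed.

(** * Exponents modulo 5 and 25 *)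

Definition supp (R : nzRingType) (L : nat) (A : pred nat) (p : {poly R}) : Prop :=
  forall i, (i < L)%N -> p`_i != 0 -> A i.

Lemma supp_sub (R : nzRingType) L (A B : pred nat) (p : {poly R}) :
  (forall i, A i -> B i) -> supp L A p -> supp L B p.
Proof. by move=> AB Ap i iL /(Ap i iL)/AB. Qed.

Lemma supp_eqX (R : nzRingType) L A (p q : {poly R}) :
  eqX L p q -> supp L A q -> supp L A p.
Proof. by move=> e Aq i iL; rewrite e //; apply: Aq. Qed.

Lemma suppD (R : nzRingType) L A (p q : {poly R}) :
  supp L A p -> supp L A q -> supp L A (p + q).
Proof.
move=> Ap Aq i iL; rewrite coefD.
have [p0|/(Ap _ iL)//] := eqVneq p`_i 0.
by rewrite p0 add0r; apply: Aq.
Qed.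

Lemma suppN (R : nzRingType) L A (p : {poly R}) : supp L A p -> supp L A (- p).
Proof. by move=> Ap i iL; rewrite coefN oppr_eq0; apply: Ap. Qed.

Lemma suppB (R : nzRingType) L A (p q : {poly R}) :
  supp L A p -> supp L A q -> supp L A (p - q).
Proof. by move=> Ap Aq; apply/suppD/suppN. Qed.

Lemma suppM (R : nzRingType) L (A B C : pred nat) (p q : {poly R}) :
  (forall i j, A i -> B j -> C (i + j)%N) ->
  supp L A p -> supp L B q -> supp L C (p * q).
Proof.
move=> ABC Ap Bq i iL; rewrite coefM; apply: contra_neqT => nC.
apply: big1 => j _; have le_ji : (j <= i)%N by rewrite -ltnS.
have [->|/(Ap _ (leq_ltn_trans le_ji iL)) Aj] := eqVneq p`_j 0.
  by rewrite mul0r.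
have [->|/(Bq _ (leq_ltn_trans (leq_subr _ _) iL)) Bj] := eqVneq q`_(i - j) 0.
  by rewrite mulr0.
by case/negP: nC; rewrite -(subnKC le_ji); apply: ABC.
Qed.

Definition cls (m r : nat) : pred nat := fun i => (i == r %[mod m])%N.

Lemma suppM_cls (R : nzRingType) L m r s (p q : {poly R}) :
  supp L (cls m r) p -> supp L (cls m s) q -> supp L (cls m (r + s)) (p * q).
Proof.
apply: suppM => i j /eqP ei /eqP ej; apply/eqP.
by rewrite -modnDm ei ej modnDm.
Qed.

Lemma suppX_cls (R : nzRingType) L m r k (p : {poly R}) :
  supp L (cls m r) p -> supp L (cls m (k * r)) (p ^+ k).
Proof.
move=> hp; elim: k => [|k IH]; last by rewrite exprS mulSn; apply: suppM_cls.
move=> i _; rewrite expr0 coef1 /cls mul0n.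
by case: i => //= i; rewrite eqxx.
Qed.

Lemma square24_mod5 i m : (24 * i + 1 = m * m)%N -> (i %% 5 < 3)%N.
Proof.
(* Modulo 5, 24 i + 1 is 1 - i, so i is 1 - m^2. *)
move=> e; suff -> : (i %% 5 = (1 + 4 * ((m %% 5) * (m %% 5))) %% 5)%N.
  by case: (m %% 5)%N (ltn_pmod m (isT : 0 < 5)%N) => [|[|[|[|[|]]]]].
by rewrite -modnDmr -modnMmr modnMm modnMmr modnDmr -e; lia.
Qed.

(** If i is 1 modulo 5, then 5 divides m^2, hence 25 does, while 24 i + 1 is 1 - i modulo 25. *)
Lemma square24_mod25 i m :
  (24 * i + 1 = m * m)%N -> (i %% 5 = 1)%N -> (i %% 25 = 1)%N.
Proof.
move=> e i1; have m5 : (m %% 5 = 0)%N.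
  have : ((m %% 5) * (m %% 5) %% 5 = 0)%N by rewrite modnMm -e; lia.
  by case: (m %% 5)%N (ltn_pmod m (isT : 0 < 5)%N) => [|[|[|[|[|]]]]].
have : (m * m = 25 * ((m %/ 5) * (m %/ 5)))%N by rewrite {1 2}(divn_eq m 5) m5; lia.
by move: (_ %/ _ * _)%N => k; lia.
Qed.

Lemma square8_mod5 i m : (8 * i + 1 = m * m)%N -> (i %% 5 \in [:: 0; 1; 3])%N.
Proof.
(* Modulo 5, 3 i = m^2 - 1, and 2 is the inverse of 3. *)
move=> e; suff -> : (i %% 5 = (3 + 2 * ((m %% 5) * (m %% 5))) %% 5)%N.
  by case: (m %% 5)%N (ltn_pmod m (isT : 0 < 5)%N) => [|[|[|[|[|]]]]].
by rewrite -modnDmr -modnMmr modnMm modnMmr modnDmr -e; lia.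
Qed.

(** * Sections modulo 5 and the relation a c = b^2 *)

Definition sect (R : nzRingType) (r : nat) (p : {poly R}) : {poly R} :=
  \poly_(i < size p) (if (i %% 5 == r)%N then p`_i else 0).

Lemma coef_sect (R : nzRingType) r (p : {poly R}) i :
  (sect r p)`_i = if (i %% 5 == r)%N then p`_i else 0.
Proof.
rewrite coef_poly; case: ltnP => // le_i.
by rewrite nth_default // if_same.
Qed.

Lemma supp_sect (R : nzRingType) L r (p : {poly R}) : (r < 5)%N ->
  supp L (cls 5 r) (sect r p).
Proof.
move=> r5 i _; rewrite coef_sect /cls (modn_small r5).
by case: ifP => //; rewrite eqxx.
Qed.

Lemma dilate_sect (R : comNzRingType) L (w : R) p : w ^+ 5 = 1 ->
  supp L (fun i => i %% 5 < 3)%N p ->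
  eqX L (dilate w p) (sect 0 p + w%:P * sect 1 p + w%:P ^+ 2 * sect 2 p).
Proof.
move=> w5 sp i iL; rewrite -rmorphXn !coefD !coefCM !coef_sect coef_dilate.
rewrite -(expr_mod i w5).
have [->|/(sp i iL)] := eqVneq p`_i 0; first by rewrite !if_same !mulr0 !addr0.
by case: (i %% 5)%N => [|[|[|]]] //= _; rewrite ?mulr0 ?addr0 ?add0r ?expr0 ?expr1 ?mul1r.
Qed.

Lemma sect_sum (R : nzRingType) L (p : {poly R}) :
  supp L (fun i => i %% 5 < 3)%N p ->
  eqX L p (sect 0 p + sect 1 p + sect 2 p).
Proof.
move=> sp i iL; rewrite !coefD !coef_sect.
have [->|/(sp i iL)] := eqVneq p`_i 0; first by rewrite !if_same !addr0.
by case: (i %% 5)%N => [|[|[|]]] //= _; rewrite ?addr0 ?add0r.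
Qed.

Lemma qprod_coef_comp (R : comNzRingType) k N i : (0 < k)%N ->
  (@qprod R k N)`_i = if (k %| i)%N then (@qprod R 1 N)`_(i %/ k) else 0.
Proof.
move=> k0; rewrite -[k in LHS]muln1 -qprod_comp.
by rewrite coef_comp_poly_Xn.
Qed.

(** Modulo 2, the part of (a + b + c)^3 in the class 2 is a (a c + b^2). It vanishes by the
    hypothesis on f^3, and a has constant term 1, so it cancels. *)
Lemma sect_geometric (F : fieldType) N (f : {poly F}) : 2 \in [pchar F] ->
  f`_0 = 1 -> supp N (fun i => i %% 5 < 3)%N f ->
  supp N (fun i => i %% 5 \in [:: 0; 1; 3])%N (f ^+ 3) ->
  eqX N (sect 0 f * sect 2 f + sect 1 f ^+ 2) 0.
Proof.
move=> c2 f0 fs f3s; set a := sect 0 f; set b := sect 1 f; set c := sect 2 f.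
have c2' : 2 \in [pchar {poly F}] by rewrite (pchar_poly F).
have two : 2 = 0 :> {poly F} by apply: (pcharf0 c2').
have ha : supp N (cls 5 0) a by apply: supp_sect.
have hb : supp N (cls 5 1) b by apply: supp_sect.
have hc : supp N (cls 5 2) c by apply: supp_sect.
apply: (@eqX_cancel _ _ a); first by rewrite coef_sect.
rewrite mulr0 => i iN; rewrite coef0.
(* Outside the class 2 the coefficient is zero because the whole product lies in that class. *)
have [i2|/negP i2] := boolP (i %% 5 == 2)%N; last first.
  apply/eqP; rewrite -[_ == _]negbK; apply/negP => nz; case: i2.
  suff /(_ i iN nz) : supp N (cls 5 2) (a * (a * c + b ^+ 2)) by [].
  apply: (suppM_cls ha (suppD _ (suppX_cls hb))).
  exact: suppM_cls ha hc.
pose rest := a ^+ 3 + c ^+ 3 + a ^+ 2 * b + b ^+ 3 + a * c ^+ 2 + b ^+ 2 * c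
  + b * c ^+ 2.
have e3 : eqX N (f ^+ 3) (rest + a * (a * c + b ^+ 2)).
  apply: eqX_trans (eqX_exp 3 (sect_sum fs)) _; rewrite -/a -/b -/c.
  have -> : (a + b + c) ^+ 3 = rest + a * (a * c + b ^+ 2)
     + 2 * (a ^+ 2 * b + a * c ^+ 2 + b ^+ 2 * c + b * c ^+ 2 + 3 * a * b * c
            + a * (a * c + b ^+ 2)) by rewrite /rest; ring.
  by rewrite two mul0r addr0.
have rest0 : supp N (fun i => i %% 5 != 2)%N rest.
  have sub r p : (r %% 5 != 2)%N -> supp N (cls 5 r) p ->
      supp N (fun i => i %% 5 != 2)%N p.
    by move=> r2; apply: supp_sub => j /eqP ->.
  rewrite /rest; do !apply: suppD.
  - by apply: sub (suppX_cls ha).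
  - by apply: sub (suppX_cls hc).
  - by apply: sub (suppM_cls (suppX_cls ha) hb).
  - by apply: sub (suppX_cls hb).
  - by apply: sub (suppM_cls ha (suppX_cls hc)).
  - by apply: sub (suppM_cls (suppX_cls hb) hc).
  - by apply: sub (suppM_cls hb (suppX_cls hc)).
have := e3 i iN; rewrite coefD.
have -> : rest`_i = 0.
  by apply/eqP; rewrite -[_ == _]negbK; apply/negP => /(rest0 i iN); rewrite i2.
have -> : (f ^+ 3)`_i = 0.
  by apply/eqP; rewrite -[_ == _]negbK; apply/negP => /(f3s i iN); rewrite (eqP i2).
by rewrite add0r => <-.
Qed.

(** In the weight 4 terms of [conj_prod_expand], a c + b^2 vanishes by [sect_geometric] and 4 = 0,
    which leaves b^4. As b lives on exponents 1 modulo 25, b^4 lives on 4. *)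
Lemma conj_prod_supp (F : fieldType) N (z : F) (f : {poly F}) : 2 \in [pchar F] ->
  1 + z + z ^+ 2 + z ^+ 3 + z ^+ 4 = 0 ->
  f`_0 = 1 -> supp N (fun i => i %% 5 < 3)%N f ->
  supp N (fun i => (i %% 5 == 1) ==> (i %% 25 == 1))%N f ->
  supp N (fun i => i %% 5 \in [:: 0; 1; 3])%N (f ^+ 3) ->
  supp N (fun i => (i %% 5 == 4) ==> (i %% 25 == 4))%N (conj_prod z f).
Proof.
move=> c2 rz f0 fs f25 f3s.
have geo := sect_geometric c2 f0 fs f3s.
have ha : supp N (cls 5 0) (sect 0 f) by apply: supp_sect.
have hb : supp N (cls 5 1) (sect 1 f) by apply: supp_sect.
have hc : supp N (cls 5 2) (sect 2 f) by apply: supp_sect.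
have hb25 : supp N (cls 25 1) (sect 1 f).
  move=> i iN; rewrite coef_sect; case: ifP => [i1|]; last by rewrite eqxx.
  by move/(f25 i iN); rewrite i1.
have z5 := pow5_root5 rz.
have c2' : 2 \in [pchar {poly F}] by rewrite (pchar_poly F).
have two : 2 = 0 :> {poly F} by apply: (pcharf0 c2').
have dil k : eqX N (dilate (z ^+ k) f) (sect 0 f + z%:P ^+ k * sect 1 f
    + z%:P ^+ (k * 2) * sect 2 f).
  rewrite exprM -rmorphXn; apply: dilate_sect => //.
  by rewrite exprAC z5 expr1n.
move: (sect 0 f) (sect 1 f) (sect 2 f) geo ha hb hc hb25 dil.
move=> a b c geo ha hb hc hb25 dil.
have rzP : 1 + z%:P + z%:P ^+ 2 + z%:P ^+ 3 + z%:P ^+ 4 = 0 :> {poly F}.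
  by have := congr1 polyC rz; rewrite !rmorphD !rmorphXn rmorph1 rmorph0.
have e := eqXM (eqXM (eqXM (dil 1%N) (dil 2)) (dil 3)) (dil 4).
apply: (supp_eqX e); rewrite [X in supp _ _ X](conj_prod_expand a b c rzP).
have -> : 4 = 2 * 2 :> {poly F} by ring.
rewrite two !mul0r subr0 !addr0.
have sub r p : (r %% 5 != 4)%N -> supp N (cls 5 r) p ->
    supp N (fun i => (i %% 5 == 4) ==> (i %% 25 == 4))%N p.
  by move=> r4; apply: supp_sub => j /eqP ->; rewrite (negPf r4).
apply: suppD; last first.
  do ?apply: suppB; do ?apply: suppD.
  - by apply: sub (suppX_cls ha).
  - by apply: sub (suppX_cls hc).
  - by apply: sub (suppM_cls (suppX_cls ha) (suppX_cls hb)).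
  - by apply: sub (suppM_cls (suppX_cls hb) (suppX_cls hc)).
  - by apply: sub (suppM_cls (suppX_cls ha) hb).
  - by apply: sub (suppM_cls ha (suppX_cls hb)).
  - by apply: sub (suppM_cls (suppX_cls hb) hc).
  - by apply: sub (suppM_cls hb (suppX_cls hc)).
  - by apply: sub (suppM_cls (suppX_cls ha) hc).
  - by apply: sub (suppM_cls ha (suppX_cls hc)).
apply: suppD.
  apply: supp_sub (suppX_cls hb25) => i /eqP e25; apply/implyP => _.
  by rewrite e25.
apply: supp_eqX (eqXMl _ geo) _ => i _.
by rewrite mulr0 coef0 eqxx.
Qed.

(** * The dissection of the generating function and the conclusion *)

Lemma regular40_dissection (F : fieldType) (z : F) N : 2 \in [pchar F] ->
  1 + z + z ^+ 2 + z ^+ 3 + z ^+ 4 = 0 ->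
  eqX N (\poly_(n < N) (regular_partitions 40 n)%:R)
    (conj_prod z (qprod 1 (5 * N)) * qprod 25 N * qprod 10 N).
Proof.
move=> c2 rz; set P := \poly_(n < N) _; pose f : {poly F} := qprod 1 (5 * N).
pose g : {poly F} := qprod 5 N; set C := conj_prod z _.
have gen : eqX N (f * P) (g ^+ 8).
  have -> : g ^+ 8 = qprod 40 N by rewrite (exprM g 2 4) (exprM _ 2 2) !qprod_sqr.
  apply: (eqX_trans _ (@regular_gen F 40 N isT)); apply: eqXMr.
  by apply: (eqX_le (leqnSn N)); apply: qprod_trunc => //; lia.
have norm : eqX N (f * C * qprod 25 N) (g ^+ 6).
  rewrite (norm_qprod N rz) (exprS g 5); apply: eqXMr.
  by apply: (eqX_le (leqnSn N)); apply: qprod_trunc => //; lia.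
have -> : qprod 10 N = g ^+ 2 by rewrite qprod_sqr.
(* After multiplication by g^6 = f C f_25, the left side is C f_25 (f P), and f P = g^8. *)
apply: (@eqX_cancel _ _ (g ^+ 6)).
  have : (g ^+ 6 - 1)`_0 = 0; last by rewrite coefB coef1 => /subr0_eq.
  have -> : g ^+ 6 - 1 = (g - 1) * (g ^+ 5 + g ^+ 4 + g ^+ 3 + g ^+ 2 + g + 1) by ring.
  by rewrite coef0M coefB coef1 qprod_coef0 // subrr mul0r.
apply: eqX_trans (eqXMr P (eqX_sym norm)) _.
rewrite (_ : _ * P = C * qprod 25 N * (f * P)); last by ring.
rewrite (_ : _ * (_ * g ^+ 2) = C * qprod 25 N * g ^+ 8); last by ring.
exact: eqXMl.
Qed.

Lemma regular40_even n : (n %% 25 \in [:: 9; 19])%N ->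
  ~~ odd (regular_partitions 40 n).
Proof.
move=> n25; have [F [z [c2 rz]]] := field_char2_root5.
(* Precision n.+1 is the least that sees the coefficient of index n. *)
pose N := n.+1; pose f : {poly F} := qprod 1 (5 * N).
have le_N i : (i < N)%N -> (i <= 5 * N)%N by lia.
have f_mod5 : supp N (fun i => i %% 5 < 3)%N f.
  by move=> i /le_N iN /(qprod1_coef iN)[m /square24_mod5].
have f_mod25 : supp N (fun i => (i %% 5 == 1) ==> (i %% 25 == 1))%N f.
  move=> i /le_N iN /(qprod1_coef iN)[m /square24_mod25 e].
  by apply/implyP => /eqP/e/eqP.
have f3 : supp N (fun i => i %% 5 \in [:: 0; 1; 3])%N (f ^+ 3).
  move=> i /le_N; rewrite /f (_ : 5 * N = (5 * n + 4).+1)%N; last by lia.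
  by move=> iN /(qprod1_cube_coef c2 iN)[m /square8_mod5].
have supp25 : supp N (cls 25 0) (@qprod F 25 N).
  by move=> i iN; rewrite qprod_coef_comp // /cls; case: ifP; rewrite ?eqxx.
have supp10 : supp N (fun i => i %% 25 \in [:: 0; 10; 20])%N (@qprod F 10 N).
  move=> i iN; rewrite qprod_coef_comp //; case: ifP => [/dvdnP[k ei]|]; last by rewrite eqxx.
  subst i; rewrite mulnK // => nz.
  have [|m /square24_mod5] := @qprod1_coef _ N k _ nz; first by lia.
  (* An exponent of f_10 is 10 k with k an exponent of f_1, so k is 0, 1 or 2 modulo 5. *)
  have -> : (k * 10 %% 25 = (k %% 5) * 10 %% 25)%N by lia.
  by case: (k %% 5)%N => [|[|[|]]].
have suppC := conj_prod_supp c2 rz (@qprod_coef0 F 1 (5 * N) isT) f_mod5 f_mod25 f3.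
have := @regular40_dissection F z N c2 rz n (ltnSn n).
rewrite coef_poly ltnSn => e.
have : supp N (fun i => i %% 25 \notin [:: 9; 19])%N
   (conj_prod z f * qprod 25 N * qprod 10 N).
  have s1 : supp N (fun i => (i %% 5 == 4) ==> (i %% 25 == 4))%N (conj_prod z f * qprod 25 N).
    apply: (suppM _ suppC supp25) => i j Ci /eqP j25.
    have [-> ->] : ((i + j) %% 5 = i %% 5 /\ (i + j) %% 25 = i %% 25)%N by lia.
    by [].
  (* Adding 0, 10 or 20 keeps the class modulo 5 and sends 4 to 4, 14 or 24 modulo 25. *)
  apply: (suppM _ s1 supp10) => i j Ci; rewrite !inE => j25.
  by lia.
move/(_ n (ltnSn n)); rewrite -e n25 => h.
have {h} h : (regular_partitions 40 n)%:R = 0 :> F.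
  by apply/eqP; apply: contraT => /h.
by move/eqP: h; rewrite -(dvdn_pcharf c2) dvdn2.
Qed.

Local Close Scope ring_scope.

Theorem theorem4 :
  forall n : nat,
    (b40 (25 * n + 9) = 0 %[mod 2]) /\ (b40 (25 * n + 19) = 0 %[mod 2]).
Proof.
move=> n; split; rewrite modn2 mod0n; apply/eqP; rewrite eqb0;
  by apply: regular40_even; rewrite -modnDml modnMr.
Qed.
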